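(* Let $x_1,\dots,x_m\in\mathbb{R}^n$, let $P_1,\dots,P_m\in\mathbb{R}^{n\times n}$ be symmetric positive definite, and let $f(P_0)$ be the ''size'' of the ellipsoid with shape matrix $P_0$, taken to be a convex function (the common choices being $\operatorname{tr}(P_0)$ or $\log\det(P_0)$). Consider the SDP relaxation (S): minimize $f(P_0)$ over symmetric positive definite $P_0\in\mathbb{R}^{n\times n}$, $\tilde x_0\in\mathbb{R}^n$ and $\lambda_1,\dots,\lambda_m\ge0$ subject to $$\begin{bmatrix} P_0^{-1}-\sum_{i=1}^m\lambda_iP_i^{-1} & -\tilde x_0+\sum_{i=1}^m\lambda_iP_i^{-1}x_i & 0\\ \left(-\tilde x_0+\sum_{i=1}^m\lambda_iP_i^{-1}x_i\right)^T & -1-\sum_{i=1}^m\lambda_i(x_i^TP_i^{-1}x_i-1) & \tilde x_0^T\\ 0&\tilde x_0&-P_0^{-1}\end{bmatrix}\preceq 0,$$ where $\tilde x_0=P_0^{-1}x_0$. Consider the S-procedure relaxation (P): minimize $f(P_0)$ over symmetric positive definite $P_0\in\mathbb{R}^{n\times n}$, $x_0\in\mathbb{R}^n$ and $\tau_1,\dots,\tau_m\ge0$ subject to $$\begin{bmatrix}P_0^{-1}&-P_0^{-1}x_0\\-x_0^TP_0^{-1}&x_0^TP_0^{-1}x_0-1\end{bmatrix}\preceq\sum_{i=1}^m\tau_i\begin{bmatrix}P_i^{-1}&-P_i^{-1}x_i\\-x_i^TP_i^{-1}&x_i^TP_i^{-1}x_i-1\end{bmatrix}.$$ Then (S) is equivalent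 to (P), i.e., they can derive the same minimum ellipsoid to contain the intersection $\bigcap_{i=1}^m\{x\in\mathbb{R}^n:(x-x_i)^TP_i^{-1}(x-x_i)\le1\}$.
   Context: $A\preceq B$ denotes the Loewner order on real symmetric matrices. The ellipsoid derived from an optimal solution of either problem is $\{x\in\mathbb{R}^n:(x-x_0)^TP_0^{-1}(x-x_0)\le1\}$, with shape matrix $P_0$ and center $x_0$ (in (S), $x_0=P_0\tilde x_0$). *)

(* Defs.v *)
From HB Require Import structures.
From mathcomp Require Import all_boot all_order all_algebra.
From mathcomp Require Import all_classical all_reals all_analysis.

Set Implicit Arguments.
Unset Strict Implicit.
Unset Printing Implicit Defensive.

Import Order.TTheory GRing.Theory Num.Theory.
Local Open Scope classical_set_scope.
Local Open Scope ring_scope.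

Section Loewner.
Context {R : realType}.

Definition qform k (A : 'M[R]_k) (v : 'cV[R]_k) : R := (v^T *m A *m v) 0 0.

Definition posdefmx k (A : 'M[R]_k) : Prop :=
  A^T = A /\ forall v : 'cV[R]_k, v != 0 -> 0 < qform A v.

Definition loewner_le k (A B : 'M[R]_k) : Prop :=
  [/\ A^T = A, B^T = B & forall v : 'cV[R]_k, 0 <= qform (B - A) v].

Definition ellipsoid n (P : 'M[R]_n) (c : 'cV[R]_n) : set 'cV[R]_n :=
  [set x | qform (invmx P) (x - c) <= 1].

End Loewner.

(* [convex_function] quantifies over a set, so convexity is required on the
   positive definite cone only.  The function [ln \det], the usual (log-)volume
   criterion, is concave there, hence the separate case; the trace is convex. *)
Definition size_function {R : realType} n (f : 'M[R]_n -> R) : Prop :=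
  convex_function [set P : 'M[R]_n | posdefmx P] f \/
  (forall P : 'M[R]_n, posdefmx P -> f P = ln (\det P)).

Section MinimizationProblem.
Context {R : realType} {T : Type}.
Implicit Types (F : set T) (obj : T -> R).

Definition minimizers F obj : set T :=
  [set z | F z /\ forall z', F z' -> obj z <= obj z'].

(* +oo when [F] is empty; the infimum need not be attained. *)
Definition optimal_value F obj : \bar R := ereal_inf [set (obj z)%:E | z in F].

End MinimizationProblem.

Section Relaxations.
Context {R : realType} {n m : nat}.
Variables (x : 'I_m -> 'cV[R]_n) (P : 'I_m -> 'M[R]_n).

(* A decision vector of either problem: a shape matrix, a vector (the center
   itself, or the center premultiplied by the inverse of the shape matrix),
   and the multipliers. *)
Definition decision : Type := ('M[R]_n * 'cV[R]_n * ('I_m -> R))%type.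

Definition shape_matrix (z : decision) : 'M[R]_n := z.1.1.

Definition sdp_mx (P0 : 'M[R]_n) (xt0 : 'cV[R]_n) (lam : 'I_m -> R) :
    'M[R]_(n + 1 + n) :=
  let A := invmx P0 - \sum_(i < m) lam i *: invmx (P i) in
  let b := - xt0 + \sum_(i < m) lam i *: (invmx (P i) *m x i) in
  let c := - 1%:M
    - \sum_(i < m) lam i *: ((x i)^T *m invmx (P i) *m x i - 1%:M) in
  block_mx (block_mx A b b^T c)          (col_mx 0 xt0^T)
           (row_mx (0 : 'M[R]_n) xt0)    (- invmx P0).

Definition sdp_feasible : set decision :=
  [set z | let: (P0, xt0, lam) := z in
    [/\ posdefmx P0, (forall i, 0 <= lam i) &
        loewner_le (sdp_mx P0 xt0 lam) 0]].

Definition ellipsoid_mx (P0 : 'M[R]_n) (x0 : 'cV[R]_n) : 'M[R]_(n + 1) :=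
  block_mx (invmx P0)               (- (invmx P0 *m x0))
           (- (x0^T *m invmx P0))   (x0^T *m invmx P0 *m x0 - 1%:M).

Definition sproc_feasible : set decision :=
  [set z | let: (P0, x0, tau) := z in
    [/\ posdefmx P0, (forall i, 0 <= tau i) &
        loewner_le (ellipsoid_mx P0 x0)
                   (\sum_(i < m) tau i *: ellipsoid_mx (P i) (x i))]].

Definition sdp_ellipsoid (z : decision) : set 'cV[R]_n :=
  let: (P0, xt0, _) := z in ellipsoid P0 (P0 *m xt0).

Definition sproc_ellipsoid (z : decision) : set 'cV[R]_n :=
  let: (P0, x0, _) := z in ellipsoid P0 x0.

End Relaxations.

Arguments decision : clear implicits.

(* Main.v *)
(** Taking the Schur complement of the block $-P_0^{-1}$ turns the matrix of (S)
    into the difference of the two sides of the matrix inequality of (P), with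
    $x_0 = P_0\tilde x_0$ and $\tau = \lambda$. Hence
    $(P_0,\tilde x_0,\lambda)\mapsto(P_0,P_0\tilde x_0,\lambda)$ is a bijection
    between the feasible sets which preserves the objective and the ellipsoid.
    Evaluating the inequality of (P) at the vector $(y,1)$ shows that every
    feasible ellipsoid contains the intersection. *)
Require Import Defs.
From HB Require Import structures.
From mathcomp Require Import all_boot all_order all_algebra.
From mathcomp Require Import all_classical all_reals all_analysis.
From mathcomp Require Import ring lra.

Set Implicit Arguments.
Unset Strict Implicit.
Unset Printing Implicit Defensive.

Import Order.TTheory GRing.Theory Num.Theory.
Local Open Scope classical_set_scope.
Local Open Scope ring_scope.

Section QuadraticForms.
Context {R : realType}.

Lemma qformD k (A B : 'M[R]_k) v : qform (A + B) v = qform A v + qform B v.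
Proof. by rewrite /qform mulmxDr mulmxDl mxE. Qed.

Lemma qformN k (A : 'M[R]_k) v : qform (- A) v = - qform A v.
Proof. by rewrite /qform mulmxN mulNmx mxE. Qed.

Lemma qformZ k a (A : 'M[R]_k) v : qform (a *: A) v = a * qform A v.
Proof. by rewrite /qform -scalemxAr -scalemxAl mxE. Qed.

Lemma qform_sum k m (A : 'I_m -> 'M[R]_k) v :
  qform (\sum_i A i) v = \sum_i qform (A i) v.
Proof. by rewrite /qform mulmx_sumr mulmx_suml summxE. Qed.

Lemma posdefmx_unit k (A : 'M[R]_k) : posdefmx A -> A \in unitmx.
Proof.
case=> _ Apos; rewrite unitmxE unitfE; apply/negP => /det0P [v v0 vA].
(* [det0P] yields a row vector in the left kernel, so positivity is applied to its transpose. *)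
have := Apos v^T; rewrite -(inj_eq trmx_inj) trmxK trmx0 => /(_ v0).
by rewrite /qform trmxK vA mul0mx mxE ltxx.
Qed.

Lemma posdefmx_inv_sym k (A : 'M[R]_k) : posdefmx A -> (invmx A)^T = invmx A.
Proof. by case=> sA _; rewrite trmx_inv sA. Qed.

(** With $w=A^{-1}v$ one has $v^TA^{-1}v=w^TAw$. *)
Lemma posdefmx_inv_qform_ge0 k (A : 'M[R]_k) v :
  posdefmx A -> 0 <= qform (invmx A) v.
Proof.
move=> pA; have uA := posdefmx_unit pA.
have -> : qform (invmx A) v = qform A (invmx A *m v).
  by rewrite /qform trmx_mul (posdefmx_inv_sym pA) mulmxKV // mulmxA.
have [->|v0] := eqVneq (invmx A *m v) 0; first by rewrite /qform mulmx0 mxE.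
by case: pA => _ /(_ _ v0) /ltW.
Qed.

Lemma loewner_le_sub k (A B : 'M[R]_k) : A^T = A -> B^T = B ->
  loewner_le (A - B) 0 <-> loewner_le A B.
Proof.
move=> sA sB; rewrite /loewner_le linearB /= sA sB trmx0 sub0r opprB.
by split=> -[].
Qed.

(** Completing the square in $w$: the form is $y^TMy+2y^TBw-w^TD^{-1}w$, maximal over $w$ at
    $w=DB^Ty$. *)
Lemma schur_complement_square k l (M : 'M[R]_k) (B : 'M[R]_(k, l)) (D : 'M[R]_l)
    (y : 'cV[R]_k) (w : 'cV[R]_l) : posdefmx D ->
  qform (block_mx M B B^T (- invmx D)) (col_mx y w) =
  qform (M + B *m D *m B^T) y - qform (invmx D) (w - D *m B^T *m y).
Proof.
move=> pD; have uD := posdefmx_unit pD; have [sD _] := pD.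
rewrite /qform tr_col_mx mul_row_block mul_row_col.
rewrite !(linearB, linearD) /= !trmx_mul trmxK sD.
rewrite !(mulmxBl, mulmxBr, mulmxDl, mulmxDr) ?mulmxA.
rewrite (mulmxK uD) (mulmxKV uD) !mulmxN !mulNmx !mxE /=.
ring.
Qed.

Lemma schur_complement_loewner_le0 k l (M : 'M[R]_k) (B : 'M[R]_(k, l))
    (D : 'M[R]_l) : posdefmx D -> M^T = M ->
  loewner_le (block_mx M B B^T (- invmx D)) 0 <->
  loewner_le (M + B *m D *m B^T) 0.
Proof.
move=> pD sM; have [sD _] := pD.
rewrite /loewner_le !trmx0 tr_block_mx trmxK sM linearN /= posdefmx_inv_sym //.
rewrite linearD /= !trmx_mul trmxK sD sM mulmxA.
split=> -[_ _ H]; split=> // v.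
  (* This choice of lower block makes the square vanish. *)
  have := H (col_mx v (D *m B^T *m v)).
  rewrite !sub0r !qformN schur_complement_square // subrr.
  by rewrite {2}/qform mulmx0 mxE subr0.
(* For an arbitrary lower block, a nonnegative square is subtracted from a nonpositive form. *)
have := H (usubmx v); have := posdefmx_inv_qform_ge0
  (dsubmx v - D *m B^T *m usubmx v) pD.
rewrite !sub0r !qformN -{4}[v]vsubmxK schur_complement_square //.
lra.
Qed.

End QuadraticForms.

Section Relaxations.
Context {R : realType} {n m : nat}.
Variables (x : 'I_m -> 'cV[R]_n) (P : 'I_m -> 'M[R]_n).
Hypothesis hP : forall i, posdefmx (P i).

Lemma ellipsoid_mx_sym (P0 : 'M[R]_n) x0 :
  posdefmx P0 -> (ellipsoid_mx P0 x0)^T = ellipsoid_mx P0 x0.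
Proof.
move=> pP; rewrite /ellipsoid_mx tr_block_mx !(linearB, linearN) /=.
by rewrite !trmx_mul !trmxK posdefmx_inv_sym // tr_scalar_mx mulmxA.
Qed.

(** Homogenization: at $(y,1)$ the matrix gives the quadratic polynomial whose sublevel set at $0$
    is the ellipsoid. *)
Lemma ellipsoid_mx_qform (P0 : 'M[R]_n) x0 y :
  qform (ellipsoid_mx P0 x0) (col_mx y 1%:M) =
  qform (invmx P0) (y - x0) - 1.
Proof.
rewrite /qform /ellipsoid_mx tr_col_mx mul_row_block mul_row_col.
rewrite tr_scalar_mx !mul1mx !mulmx1 !linearB /=.
rewrite !(mulmxBl, mulmxBr, mulmxDl, mulmxDr, mulmxN, mulNmx) !mulmxA.
rewrite !mxE eqxx mulr1n; ring.
Qed.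

Lemma sum_ellipsoid_mx_sym (tau : 'I_m -> R) :
  (\sum_i tau i *: ellipsoid_mx (P i) (x i))^T =
  \sum_i tau i *: ellipsoid_mx (P i) (x i).
Proof.
rewrite linear_sum; apply: eq_bigr => i _.
by rewrite linearZ /= ellipsoid_mx_sym.
Qed.

Lemma sum_block_mx k l p q (A : 'I_m -> 'M[R]_(k, p)) (B : 'I_m -> 'M[R]_(k, q))
    (C : 'I_m -> 'M[R]_(l, p)) (D : 'I_m -> 'M[R]_(l, q)) :
  \sum_i block_mx (A i) (B i) (C i) (D i) =
  block_mx (\sum_i A i) (\sum_i B i) (\sum_i C i) (\sum_i D i).
Proof.
(* Generalized to any list of indices so that induction applies. *)
have h : forall s : seq 'I_m, \sum_(i <- s) block_mx (A i) (B i) (C i) (D i) =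
  block_mx (\sum_(i <- s) A i) (\sum_(i <- s) B i)
           (\sum_(i <- s) C i) (\sum_(i <- s) D i).
  elim=> [|i s IH]; first by rewrite !big_nil block_mx0.
  by rewrite !big_cons IH add_block_mx.
exact: h.
Qed.

Lemma sdp_feasibleP (P0 : 'M[R]_n) xt0 lam :
  sdp_feasible x P (P0, xt0, lam) <->
  sproc_feasible x P (P0, P0 *m xt0, lam).
Proof.
suff E : posdefmx P0 -> loewner_le (sdp_mx x P P0 xt0 lam) 0 <->
    loewner_le (ellipsoid_mx P0 (P0 *m xt0))
               (\sum_i lam i *: ellipsoid_mx (P i) (x i)).
  by split=> -[pP lam0 L]; split=> //; apply/(E pP).
move=> pP; have uP := posdefmx_unit pP; have [sP _] := pP.
rewrite -(loewner_le_sub (A := ellipsoid_mx _ _)) ?ellipsoid_mx_sym ?sum_ellipsoid_mx_sym //.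
rewrite /sdp_mx.
set A := invmx P0 - _; set b := - xt0 + _; set c := - 1%:M - _.
have sA : A^T = A.
  rewrite /A linearB linear_sum /= posdefmx_inv_sym //; congr (_ - _).
  by apply: eq_bigr => i _; rewrite linearZ /= posdefmx_inv_sym.
have sc : c^T = c by apply/matrixP => i j; rewrite mxE !ord1.
(* The border must have the shape $B$, $B^T$ with $B$ the column $(0,\tilde x_0^T)$ for the Schur
   complement to apply. *)
have -> : row_mx (0 : 'M[R]_n) xt0 = (col_mx (0 : 'M[R]_n) xt0^T)^T.
  by rewrite tr_col_mx trmx0 trmxK.
rewrite schur_complement_loewner_le0 //; last first.
  by rewrite tr_block_mx trmxK sA sc.
suff -> : block_mx A b b^T c + col_mx 0 xt0^T *m P0 *m (col_mx 0 xt0^T)^T =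
    ellipsoid_mx P0 (P0 *m xt0) - \sum_i lam i *: ellipsoid_mx (P i) (x i) by [].
rewrite /ellipsoid_mx; under eq_bigr do rewrite scale_block_mx.
rewrite sum_block_mx opp_block_mx add_block_mx.
(* The only nonzero block of $BP_0B^T$ is the corner $\tilde x_0^TP_0\tilde x_0$, which is
   $x_0^TP_0^{-1}x_0$ for $x_0=P_0\tilde x_0$. *)
rewrite tr_col_mx trmx0 trmxK mul_col_mx mul_col_row !mul0mx mulmx0.
rewrite add_block_mx !addr0 trmx_mul sP !mulmxA mulVmx // mul1mx mulmxK //.
(* The minus signs in the off-diagonal blocks of [ellipsoid_mx] cancel against the subtraction of
   the sum. *)
have sumN p q (F : 'I_m -> 'M[R]_(p, q)) :
    - (\sum_i lam i *: - F i) = \sum_i lam i *: F i.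
  by rewrite -sumrN; apply: eq_bigr => i _; rewrite scalerN opprK.
congr block_mx.
- by rewrite sumN.
- rewrite sumN /b linearD linearN linear_sum /=; congr (_ + _).
  apply: eq_bigr => i _; rewrite linearZ /= trmx_mul.
  by rewrite posdefmx_inv_sym.
- by rewrite /c addrC addrA.
Qed.

Lemma sproc_feasible_contains z : sproc_feasible x P z ->
  \bigcap_(i in [set: 'I_m]) ellipsoid (P i) (x i) `<=` sproc_ellipsoid z.
Proof.
case: z => [[P0 x0] tau] [pP tau0 [_ _ L]] y yI.
have := L (col_mx y 1%:M).
rewrite qformD qformN qform_sum ellipsoid_mx_qform => L1.
(* Each term is a multiplier $\tau_i\ge0$ times a value that is nonpositive because $y$ lies in the
   $i$-th ellipsoid. *)
suff : \sum_i qform (tau i *: ellipsoid_mx (P i) (x i)) (col_mx y 1%:M) <= 0.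
  by rewrite /sproc_ellipsoid /ellipsoid /=; lra.
apply: sumr_le0 => i _; rewrite qformZ ellipsoid_mx_qform.
by rewrite mulr_ge0_le0 // subr_le0; exact: yI.
Qed.

Definition sproc_of_sdp (z : decision R n m) : decision R n m :=
  (z.1.1, z.1.1 *m z.1.2, z.2).

Lemma sdp_feasibleE z : sdp_feasible x P z <-> sproc_feasible x P (sproc_of_sdp z).
Proof. by case: z => [[P0 xt0] lam]; exact: sdp_feasibleP. Qed.

Lemma sdp_ellipsoidE (z : decision R n m) :
  sdp_ellipsoid z = sproc_ellipsoid (sproc_of_sdp z).
Proof. by case: z => [[]]. Qed.

(** Surjectivity of the change of variables: $\tilde x_0=P_0^{-1}x_0$ is available since feasibility
    makes $P_0$ invertible. *)
Lemma sproc_feasible_preimage z : sproc_feasible x P z ->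
  exists2 z', sdp_feasible x P z' & sproc_of_sdp z' = z.
Proof.
case: z => [[P0 x0] tau] Fz; have [pP _ _] := Fz.
have E : P0 *m (invmx P0 *m x0) = x0 by rewrite mulKVmx // posdefmx_unit.
exists (P0, invmx P0 *m x0, tau); last by rewrite /sproc_of_sdp /= E.
by apply/sdp_feasibleE; rewrite /sproc_of_sdp /= E.
Qed.

Lemma sdp_minimizersE (f : 'M[R]_n -> R) z :
  let obj := fun z : decision R n m => f (shape_matrix z) in
  minimizers (sdp_feasible x P) obj z <->
  minimizers (sproc_feasible x P) obj (sproc_of_sdp z).
Proof.
move=> obj; split=> -[/sdp_feasibleE Fz zmin]; split=> //.
  (* Every competitor in (P) is the image of one in (S) with the same shape matrix, hence the same
     objective. *)
  by move=> _ /sproc_feasible_preimage[z2 Fz2 <-]; exact: (zmin z2).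
by move=> z' /sdp_feasibleE; exact: (zmin (sproc_of_sdp z')).
Qed.

End Relaxations.

Theorem proposition4p2 (R : realType) (n m : nat)
  (x : 'I_m -> 'cV[R]_n) (P : 'I_m -> 'M[R]_n) (f : 'M[R]_n -> R)
  (hP : forall i, posdefmx (P i)) (hf : size_function f) :
  let obj := fun z : decision R n m => f (shape_matrix z) in
  let optS := minimizers (sdp_feasible x P) obj in
  let optP := minimizers (sproc_feasible x P) obj in
  [/\ (forall (P0 : 'M[R]_n) (x0 : 'cV[R]_n),
         (exists (xt0 : 'cV[R]_n) (lam : 'I_m -> R),
            x0 = P0 *m xt0 /\ sdp_feasible x P (P0, xt0, lam)) <->
         (exists tau : 'I_m -> R, sproc_feasible x P (P0, x0, tau))),
      optimal_value (sdp_feasible x P) obj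
        = optimal_value (sproc_feasible x P) obj,
      [set sdp_ellipsoid z | z in optS] = [set sproc_ellipsoid z | z in optP] &
      (forall z : decision R n m, optS z ->
         \bigcap_(i in [set: 'I_m]) ellipsoid (P i) (x i) `<=` sdp_ellipsoid z)
      /\
      (forall z : decision R n m, optP z ->
         \bigcap_(i in [set: 'I_m]) ellipsoid (P i) (x i)
           `<=` sproc_ellipsoid z)].
Proof.
move=> obj optS optP; split.
- move=> P0 x0; split.
    by move=> [xt0 [lam [-> /(sdp_feasibleP x hP) F]]]; exists lam.
  move=> [tau /(sproc_feasible_preimage hP)[[[P1 xt0] lam] F [E <- _]]].
  by rewrite -E; exists xt0, lam.
(* Both infima range over the same set of objective values. *)
- congr ereal_inf; apply/seteqP; split=> _ [z Fz <-].
    by exists (sproc_of_sdp z) => //; exact/sdp_feasibleE.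
  by have [z' Fz' <-] := sproc_feasible_preimage hP Fz; exists z'.
- apply/seteqP; split=> _ [z zopt <-].
    exists (sproc_of_sdp z); first exact/(sdp_minimizersE x hP).
    by rewrite sdp_ellipsoidE.
  have [z' _ E] := sproc_feasible_preimage hP zopt.1.
  exists z'; first by apply/(sdp_minimizersE x hP); rewrite E.
  by rewrite sdp_ellipsoidE E.
(* Containment follows from feasibility of the optimal point, transported to (P) in the case of
   (S). *)
- split=> z [Fz _]; last exact: sproc_feasible_contains.
  rewrite sdp_ellipsoidE; apply: sproc_feasible_contains.
  exact/sdp_feasibleE.
Qed.
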